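(* Let $m\in\mathbb{N}$ and let $\mathbb{Y}_m$ be the continuous random noble means hull. Each random noble means set $\Lambda\in\mathbb{Y}_m$ is a Meyer set.
   Context: Let $\lambda_m=(m+\sqrt{m^2+4})/2$. Random noble means substitution. Let $\boldsymbol{p}_m=(p_0,\dots,p_m)$ be a probability vector with all $p_j>0$ (standing assumption). On words over $\{\mathtt a,\mathtt b\}$, $\zeta_m$ maps $\mathtt a\mapsto \mathtt a^{i}\mathtt b\mathtt a^{m-i}$ with probability $p_i$ ($0\le i\le m$) and $\mathtt b\mapsto\mathtt a$; it is applied letter by letter, the image of each letter being chosen separately and independently, and the images are concatenated. Any possible outcome is called an image; images under $\zeta_m^k$ are obtained by iterating. Generating random noble means words. These are the elements of the set $X_m$ of all $w\in\{\mathtt a,\mathtt b\}^{\mathbb{Z}}$ (product topology) that are accumulation points of a sequence $(\zeta_m^k(\mathtt a|\mathtt a))_{k\in\mathbb{N}_0}$ of images of $\mathtt a|\mathtt a$, where $|$ marks the origin (between positions $-1$ and $0$) and finite words are regarded as embedded in $\{\mathtt a,\mathtt b\}^{\mathbb{Z}}$. Generating random noble means sets. These are the geometric realisations of generating random noble means words: each letter $\mathtt a$ is replaced by an interval of length $\lambda_m$ and each letter $\mathtt b$ by an interval of length $1$, laid out consecutively along $\mathbb{R}$ according to the word, with the left endpoint of the interval of the letter at position $0$ placed at $0$; the set consists of all left endpoints. Continuous hull. $\mathbb{Y}_m$ is the smallest collection of subsets of $\mathbb{R}$ that contains all generating random noble means sets, is invariant under all translations by $t\in\mathbb{R}$, and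 is closed in the local topology (in which two point sets are close if, after a small translation, they agree on a large ball around $0$). Elements of $\mathbb{Y}_m$ are called random noble means sets. Meyer set: a set $\Lambda\subset\mathbb{R}$ that is relatively dense and such that $\Lambda-\Lambda=\{x-y:x,y\in\Lambda\}$ is uniformly discrete. *)

(* Defs.v *)
From HB Require Import structures.
From mathcomp Require Import all_boot all_order all_algebra.
From mathcomp Require Import all_classical all_reals all_analysis.

Set Implicit Arguments.
Unset Strict Implicit.
Unset Printing Implicit Defensive.

Import Order.TTheory GRing.Theory Num.Theory.
Import numFieldNormedType.Exports.

Local Open Scope classical_set_scope.
Local Open Scope ring_scope.

(* [bool] is used because it carries the discrete topology, so that
   [prod_topology (fun=> letter)] is the usual full shift. *)
Notation letter := bool.
Definition la : letter := true.
Definition lb : letter := false.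

Definition biinf := prod_topology (fun _ : int => letter).
HB.instance Definition _ := Topological.on biinf.

Section RandomSubstitution.
Variables (R : realType) (m : nat) (p : 'I_m.+1 -> R).

Definition prob_vector := (forall j, 0 < p j) /\ \sum_j p j = 1.

Definition inserted_b (i : nat) : seq letter :=
  nseq i la ++ lb :: nseq (m - i) la.

Definition zeta_letter (x : letter) (w : seq letter) : R :=
  if x == la then \sum_(i < m.+1 | w == inserted_b i) p i
  else (w == [:: la])%:R.

(* Probability that the image of [u] is [w]. Letters of [u] are substituted
   independently, so one sums over the length [k] of the image of the first
   letter. *)
Fixpoint zeta_word (u w : seq letter) : R :=
  if u is x :: u' then
    \sum_(k < (size w).+1) zeta_letter x (take k w) * zeta_word u' (drop k w)
  else (w == [::])%:R.

Definition is_image (u w : seq letter) : Prop := 0 < zeta_word u w.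

Fixpoint iter_image (k : nat) (u w : seq letter) : Prop :=
  if k is k'.+1 then exists2 v, iter_image k' u v & is_image v w else w = u.

(* A marked word [l|r] is the pair [(l, r)]. *)
Definition marked_image (k : nat) (u w : seq letter * seq letter) : Prop :=
  iter_image k u.1 w.1 /\ iter_image k u.2 w.2.

(* [Negz n] is the integer -(n+1), so position -1 holds the last letter of the
   left part. The padding outside the finite word is immaterial for
   accumulation points below, as both parts grow without bound. *)
Definition embed (w : seq letter * seq letter) : biinf := fun n : int =>
  match n with
  | Posz n => nth lb w.2 n
  | Negz n => nth lb (rev w.1) n
  end.

Definition generating_words : set biinf :=
  [set w | exists2 u : nat -> seq letter * seq letter,
     forall k, marked_image k ([:: la], [:: la]) (u k) &
     cluster ((fun k => embed (u k)) @ \oo) w].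

Definition lambda : R := (m%:R + Num.sqrt (m%:R ^+ 2 + 4)) / 2.

Definition tile_length (x : letter) : R := if x == la then lambda else 1.

Definition left_endpoint (w : biinf) (n : int) : R :=
  match n with
  | Posz n => \sum_(i < n) tile_length (w (Posz i))
  | Negz n => - \sum_(i < n.+1) tile_length (w (Negz i))
  end.

Definition realisation (w : biinf) : set R := range (left_endpoint w).

End RandomSubstitution.

Definition translate (R : realType) (t : R) (L : set R) : set R :=
  [set x + t | x in L].

Section LocalTopology.
Variable R : realType.

Definition pointset := set R.

Definition local_ball (e : R) (L : pointset) : set pointset :=
  [set M | exists2 t, ball (0 : R) e t &
     L `&` ball (0 : R) e^-1 = translate t M `&` ball (0 : R) e^-1].

Definition local_open (O : set pointset) : Prop :=
  forall L, O L -> exists2 e : R, 0 < e & local_ball e L `<=` O.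

Lemma le_local_ball (e d : R) (L : pointset) : 0 < e -> e <= d ->
  local_ball e L `<=` local_ball d L.
Proof.
move=> e0 ed M [t te LM]; exists t; first exact: le_ball te.
have de : ball (0 : R) d^-1 `<=` ball (0 : R) e^-1.
  by apply: le_ball; rewrite lef_pV2 // posrE (lt_le_trans e0).
by rewrite -(setIidr de) !setIA LM.
Qed.

Lemma local_openT : local_open setT.
Proof. by move=> L _; exists 1. Qed.

Lemma local_openI : setI_closed local_open.
Proof.
move=> A B oA oB L [/oA[e e0 eA] /oB[d d0 dB]].
exists (Num.min e d); first by rewrite lt_min e0.
move=> M LM; split; [apply: eA | apply: dB].
  by apply: le_local_ball LM; rewrite ?lt_min ?e0 ?ge_min ?lexx.
by apply: le_local_ball LM; rewrite ?lt_min ?e0 ?ge_min ?lexx ?orbT.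
Qed.

Lemma local_open_bigU (I : Type) (f : I -> set pointset) :
  (forall i, local_open (f i)) -> local_open (\bigcup_i f i).
Proof.
move=> of_ L [i _ /of_[e e0 ef]]; exists e => // M /ef fM.
by exists i.
Qed.

HB.instance Definition _ := Choice.on pointset.
HB.instance Definition _ := isOpenTopological.Build pointset
  local_openT local_openI local_open_bigU.

End LocalTopology.

Definition translation_invariant (R : realType) (Y : set (pointset R)) : Prop :=
  forall (t : R) (L : pointset R), Y L -> Y (translate t L).

Definition generating_sets (R : realType) (m : nat) (p : 'I_m.+1 -> R) :
    set (pointset R) :=
  [set realisation m w | w in generating_words p].

Definition continuous_hull (R : realType) (m : nat) (p : 'I_m.+1 -> R) :
    set (pointset R) :=
  smallest [set Y | translation_invariant Y /\ closed Y] (generating_sets p).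

Section Meyer.
Variable R : realType.

Definition relatively_dense (L : set R) : Prop :=
  exists2 r : R, 0 < r & forall x, exists2 y, L y & `|x - y| <= r.

Definition uniformly_discrete (L : set R) : Prop :=
  exists2 r : R, 0 < r & forall x y, L x -> L y -> x != y -> r <= `|x - y|.

Definition difference_set (L : set R) : set R :=
  [set x - y | x in L & y in L].

Definition Meyer (L : set R) : Prop :=
  relatively_dense L /\ uniformly_discrete (difference_set L).

End Meyer.

(* Main.v *)
Require Import Defs.
From mathcomp Require Import all_boot all_order all_algebra.
From mathcomp Require Import all_classical all_reals all_analysis.
From mathcomp Require Import ring lra zify.

Set Implicit Arguments.
Unset Strict Implicit.
Unset Printing Implicit Defensive.

Import Order.TTheory GRing.Theory Num.Theory.
Import numFieldNormedType.Exports.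

Local Open Scope classical_set_scope.
Local Open Scope ring_scope.

(** Write [lambda'] for the algebraic conjugate of [lambda].  The conjugate
    length of a word, in which an [a] counts [lambda'] and a [b] counts [1], is
    multiplied by [lambda'] under the substitution, whatever the random choices.
    As [|lambda'| < 1], the conjugate lengths of all prefixes of all iterated
    images of [a] are bounded by a single constant, so every generating set lies
    in a cut-and-project set [{k lambda + l : |k lambda' + l| <= c}].  Such a
    set is uniformly discrete because the norm of a nonzero [k lambda + l] is a
    nonzero integer.  Finally, the condition that every point of the line is
    within [lambda] of the set and all differences lie in a given set is
    invariant under translations and closed in the local topology, so it passes
    to the hull. *)

(** * The conjugate of lambda and cut-and-project sets *)

Section Conjugate.
Variables (R : realType) (m : nat).
Hypothesis m_gt0 : (0 < m)%N.
Local Notation lambda := (@lambda R m).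

(** By Vieta, the second root of [x^2 = m x + 1]. *)
Definition conj_lambda : R := m%:R - lambda.

Lemma lambda_sqr : lambda ^+ 2 = m%:R * lambda + 1.
Proof.
rewrite /lambda; set s := Num.sqrt _.
have s2 : s ^+ 2 = m%:R ^+ 2 + 4 by rewrite sqr_sqrtr // addr_ge0 // sqr_ge0.
have -> : ((m%:R + s) / 2) ^+ 2 = (m%:R ^+ 2 + 2 * m%:R * s + s ^+ 2) / 4.
  by field.
by rewrite s2; field.
Qed.

Lemma lambda_gt1 : 1 < lambda.
Proof.
have m1 : 1 <= m%:R :> R by rewrite ler1n.
have := lambda_sqr.
have : m%:R <= lambda * 2.
  by rewrite /lambda divfK ?pnatr_eq0 // lerDl sqrtr_ge0.
nra.
Qed.

Lemma conj_lambda_sqr : conj_lambda ^+ 2 = m%:R * conj_lambda + 1.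
Proof. by rewrite /conj_lambda; have := lambda_sqr; nra. Qed.

Lemma mul_lambda_conj : lambda * conj_lambda = -1.
Proof. by rewrite /conj_lambda; have := lambda_sqr; nra. Qed.

Lemma conj_lambda_neq0 : conj_lambda != 0.
Proof.
apply/eqP => h; have := mul_lambda_conj.
by rewrite h mulr0 => /eqP; rewrite eq_sym oppr_eq0 oner_eq0.
Qed.

Lemma norm_conj_lambda_lt1 : `|conj_lambda| < 1.
Proof.
by rewrite ltr_norml; have := mul_lambda_conj; have := lambda_gt1; nra.
Qed.

(* Descent: multiplying by [conj_lambda] turns a relation with coefficients
   [(k, l)] into one with [(l, k - l m)], and [|l| = |k| |conj_lambda| < |k|]. *)
Lemma conj_lambda_irrational (k l : int) :
  k%:~R * conj_lambda + l%:~R = 0 -> k = 0.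
Proof.
have [n] := ubnP `|k|%N; elim: n k l => // n IHn k l kn kl.
have kl' : k%:~R * conj_lambda = - l%:~R by apply/eqP; rewrite -addr_eq0 kl.
apply/eqP; apply/negPn/negP => k0.
have lk : (`|l| < `|k|)%N.
  rewrite -ltz_nat !abszE -(ltr_int R) !intr_norm -(normrN l%:~R) -kl' normrM.
  by rewrite -{2}[`|_|]mulr1 ltr_pM2l ?normr_gt0 ?intr_eq0
    ?norm_conj_lambda_lt1.
have l0 : l = 0.
  apply: (IHn l (k - l * m%:Z)); first exact: leq_trans lk _.
  rewrite rmorphB rmorphM /=.
  have -> : l%:~R = - (k%:~R * conj_lambda) :> R by rewrite kl' opprK.
  rewrite !mulNr opprK -mulrA -expr2 conj_lambda_sqr -pmulrn; ring.
move: kl'; rewrite l0 oppr0 => /eqP.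
by rewrite mulf_eq0 intr_eq0 (negbTE k0) (negbTE conj_lambda_neq0).
Qed.

(** The coordinates are quantified instead of being given by a star map, so that closure under
    differences needs no uniqueness of [k] and [l]. *)
Definition cut_project (c : R) : set R := [set x | exists k l : int,
  x = k%:~R * lambda + l%:~R /\ `|k%:~R * conj_lambda + l%:~R| <= c].

Lemma cut_projectB c d x y :
  cut_project c x -> cut_project d y -> cut_project (c + d) (x - y).
Proof.
move=> [k [l [-> klc]]] [k' [l' [-> kld]]]; exists (k - k'), (l - l').
rewrite !rmorphB /=; split; first by ring.
apply: le_trans (lerD klc kld); apply: le_trans (ler_normB _ _).
by rewrite mulrBl addrACA -opprD.
Qed.

Lemma cut_projectN c x : cut_project c x -> cut_project c (- x).
Proof.
move=> xc; rewrite -[c]add0r -sub0r; apply: cut_projectB => //.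
by exists 0, 0; rewrite !mulr0z !mul0r !addr0 normr0.
Qed.

Lemma cut_project_neq0 c x : 0 < c -> cut_project c x -> x != 0 -> c^-1 <= `|x|.
Proof.
move=> c0 [k [l [-> klc]]] x0.
set z := k%:~R * conj_lambda + l%:~R in klc *.
have z0 : z != 0.
  apply: contra_neq x0 => z0; have k0 := conj_lambda_irrational z0.
  by move: z0; rewrite /z k0 !mul0r.
(* The norm of [k lambda + l], computed from the trace [m] and the norm [-1] of [lambda]. *)
have zx : (k%:~R * lambda + l%:~R) * z
    = (l * l + m%:Z * k * l - k * k)%:~R.
  rewrite rmorphB rmorphD !rmorphM /= -pmulrn /z.
  transitivity (l%:~R ^+ 2 + (lambda + conj_lambda) * k%:~R * l%:~R
    + k%:~R ^+ 2 * (lambda * conj_lambda)); first by ring.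
  by rewrite mul_lambda_conj /conj_lambda; ring.
have N1 : 1 <= `|(k%:~R * lambda + l%:~R) * z|.
  have := mulf_neq0 x0 z0; rewrite zx intr_eq0 => N0.
  by rewrite -intr_norm -[1]/(1%:~R) ler_int -gtz0_ge1 normr_gt0.
rewrite -[c^-1]mul1r ler_pdivrMr //; apply: le_trans N1 _.
by rewrite normrM ler_wpM2l.
Qed.

Lemma cut_project_uniformly_discrete c : 0 <= c ->
  uniformly_discrete (cut_project c).
Proof.
(* Differences have window [c + c]; the added 1 keeps the bound positive when [c = 0]. *)
move=> c0; exists (c + c + 1)^-1; first by rewrite invr_gt0 ltr_wpDl ?addr_ge0.
move=> x y xc yc xy; apply: cut_project_neq0; rewrite ?subr_eq0 //.
  by rewrite ltr_wpDl ?addr_ge0.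
have [k [l [-> klc]]] := cut_projectB xc yc.
by exists k, l; split=> //; rewrite (le_trans klc) // lerDl.
Qed.

End Conjugate.

(** * Lengths of finite words *)

Section Words.
Variable R : realType.

(** Generic in [z] to serve twice: [lambda] gives the geometric length, [conj_lambda] the conjugate
    one. *)
Definition weight (z : R) (s : seq letter) : R :=
  \sum_(x <- s) (if x == la then z else 1).

Lemma weight_cat z s t : weight z (s ++ t) = weight z s + weight z t.
Proof. exact: big_cat. Qed.

Lemma weight_rev z s : weight z (rev s) = weight z s.
Proof. by rewrite /weight; apply: perm_big; rewrite perm_rev. Qed.

Lemma weight_count z s :
  weight z s = (count_mem la s)%:R * z + (count_mem lb s)%:R.
Proof.
elim: s => [|x s IHs]; first by rewrite /weight big_nil mul0r addr0.
by rewrite /weight big_cons -/(weight z s) IHs; case: x => /=; ring.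
Qed.

Lemma weight_bound z s : `|z| <= 1 -> `|weight z s| <= (size s)%:R.
Proof.
move=> z1; rewrite -sum1_size natr_sum; apply: le_trans (ler_norm_sum _ _ _) _.
by apply: ler_sum => x _; case: ifP; rewrite ?normr1.
Qed.

Lemma weight_nth z (s : seq letter) n : (n <= size s)%N ->
  weight z (take n s) = \sum_(i < n) (if nth lb s i == la then z else 1).
Proof.
move=> ns; rewrite /weight (big_nth lb) big_mkord size_takel //.
by apply: eq_bigr => i _; rewrite nth_take.
Qed.

(** A prefix of [rev s] is a reversed suffix of [s], whose weight is a difference of two prefix
    weights. This serves the left half of a marked word, read from the origin outwards. *)
Lemma weight_take_bound z c s n : (forall j, `|weight z (take j s)| <= c) ->
  `|weight z (take n (rev s))| <= c + c.
Proof.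
move=> sc; rewrite take_rev weight_rev.
have := weight_cat z (take (size s - n) s) (drop (size s - n) s).
rewrite cat_take_drop => ws.
have -> : weight z (drop (size s - n) s) =
    weight z s - weight z (take (size s - n) s) by rewrite ws addrC addKr.
apply: le_trans (ler_normB _ _) _.
by rewrite lerD // -[s in weight z s]take_size.
Qed.

End Words.

(** * Conjugate lengths of random images and of their limits *)

Section Images.
Variables (R : realType) (m : nat) (p : 'I_m.+1 -> R).
Hypothesis m_gt0 : (0 < m)%N.
Hypothesis p_prob : prob_vector p.
Local Notation conj := (@conj_lambda R m).

Lemma zeta_letter_ge0 x w : 0 <= zeta_letter p x w.
Proof.
rewrite /zeta_letter; case: ifP => // _.
by apply: sumr_ge0 => i _; apply/ltW/(proj1 p_prob).
Qed.

Lemma zeta_word_ge0 u w : 0 <= zeta_word p u w.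
Proof.
elim: u w => [|x u IHu] w //=.
by apply: sumr_ge0 => k _; rewrite mulr_ge0 ?zeta_letter_ge0.
Qed.

Lemma zeta_letterP x w : 0 < zeta_letter p x w ->
  if x == la then exists2 i : nat, (i <= m)%N & w = inserted_b m i
  else w = [:: la].
Proof.
rewrite /zeta_letter; case: ifP => _; last by case: eqP; rewrite ?ltxx.
move=> /lt0r_neq0 /eqP h; apply: contrapT => nw; apply: h.
apply: big_pred0 => i; apply/negP => /eqP wi; apply: nw.
by exists i => //; rewrite -ltnS.
Qed.

Lemma is_image_nil w : is_image p [::] w -> w = [::].
Proof. by rewrite /is_image /=; case: eqP; rewrite ?ltxx. Qed.

Lemma is_image_cons x u w : is_image p (x :: u) w ->
  exists v v', [/\ w = v ++ v', 0 < zeta_letter p x v & is_image p u v'].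
Proof.
rewrite /is_image /= => /lt0r_neq0 /eqP h; apply: contrapT => nw; apply: h.
apply: big1 => k _; apply/eqP; rewrite mulf_eq0; apply/norP => -[h1 h2].
apply: nw; exists (take k w), (drop k w); rewrite cat_take_drop; split=> //.
  by rewrite lt0r h1 zeta_letter_ge0.
by rewrite lt0r h2 zeta_word_ge0.
Qed.

Lemma count_inserted_b i x : (i <= m)%N ->
  count_mem x (inserted_b m i) = if x == la then m else 1%N.
Proof.
move=> im; rewrite /inserted_b count_cat /= !count_nseq.
by case: x => /=; rewrite ?mul1n ?mul0n ?add0n ?subnKC.
Qed.

Lemma zeta_letter_count x v y : 0 < zeta_letter p x v ->
  count_mem y v = if x == la then (if y == la then m else 1%N) else (y == la).
Proof.
move=> /zeta_letterP; case: x => /= [[i im ->]|->].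
  exact: count_inserted_b.
by case: y.
Qed.

Lemma zeta_letter_size x v : 0 < zeta_letter p x v -> (size v <= m.+1)%N.
Proof.
move=> /zeta_letterP; case: x => /= [[i im ->]|-> //].
by rewrite size_cat /= !size_nseq addnS subnKC.
Qed.

(** Letter counts do not depend on where the [b] is inserted; for [a] the claim becomes
    [m conj + 1 = conj^2]. *)
Lemma zeta_letter_weight x v : 0 < zeta_letter p x v ->
  weight conj v = conj * weight conj [:: x].
Proof.
move=> xv; rewrite !weight_count !(zeta_letter_count _ xv).
case: x {xv} => /=; last by ring.
by rewrite !mul1r !addr0 -expr2 conj_lambda_sqr.
Qed.

(** A prefix of [v] consists of the full images of the first [j] letters of [u] and a piece of one
    further image, which has at most [m + 1] letters. *)
Lemma is_image_weight_take u v n : is_image p u v ->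
  exists j,
    `|weight conj (take n v) - conj * weight conj (take j u)| <= m.+1%:R.
Proof.
elim: u v n => [|x u IHu] v n.
  move=> /is_image_nil ->; exists 0%N.
  by rewrite /weight !big_nil mulr0 subrr normr0.
move=> /is_image_cons[v1 [v2 [-> xv1 uv2]]].
have [nv1|v1n] := ltnP n (size v1).
  exists 0%N; rewrite take_cat nv1 take0 {2}/weight big_nil mulr0 subr0.
  apply: le_trans (weight_bound _ (ltW (norm_conj_lambda_lt1 R m_gt0))) _.
  by rewrite ler_nat size_take nv1 (leq_trans (ltnW nv1)) //
    (zeta_letter_size xv1).
have [j hj] := IHu v2 (n - size v1)%N uv2.
exists j.+1; rewrite take_cat ltnNge v1n /= -cat1s !weight_cat.
by rewrite (zeta_letter_weight xv1) mulrDr opprD addrACA subrr add0r.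
Qed.

Lemma is_image_count u v : is_image p u v ->
  count_mem la v = (m * count_mem la u + count_mem lb u)%N /\
  count_mem lb v = count_mem la u.
Proof.
elim: u v => [|x u IHu] v; first by move=> /is_image_nil ->; rewrite muln0.
move=> /is_image_cons[v1 [v2 [-> xv1 /IHu[uv2 uv2']]]] /=.
rewrite !count_cat !(zeta_letter_count _ xv1) uv2 uv2' mulnDr addnACA.
by case: x {xv1}; rewrite /= ?muln1 ?muln0 ?addn0.
Qed.

Lemma size_count_letter (s : seq letter) :
  size s = (count_mem la s + count_mem lb s)%N.
Proof. by elim: s => //= x s ->; case: x; rewrite ?addSn ?addnS. Qed.

(** Only an [a] makes the word longer, so its presence is carried through the induction. *)
Lemma iter_image_size k u : iter_image p k [:: la] u ->
  (k < size u)%N /\ (0 < count_mem la u)%N.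
Proof.
elim: k u => [|k IHk] u; first by move=> /= ->.
move=> /= [v /IHk[kv va] /is_image_count[ua ub]].
move: kv; rewrite !size_count_letter ua ub; nia.
Qed.

(** The fixed point of [t = (m + 1) + |conj| t], the recursion for the error from one substitution
    to the next. *)
Definition prefix_bound : R := m.+1%:R / (1 - `|conj|).

Let conj_lt1 : 0 < 1 - `|conj|.
Proof. by rewrite subr_gt0 norm_conj_lambda_lt1. Qed.

Lemma prefix_bound_ge : m.+1%:R <= prefix_bound.
Proof. by rewrite ler_pdivlMr // ler_piMr // gerBl. Qed.

Lemma prefix_boundE : m.+1%:R + `|conj| * prefix_bound = prefix_bound.
Proof. by rewrite /prefix_bound; field; rewrite gt_eqF. Qed.

Lemma iter_image_weight_take k u n : iter_image p k [:: la] u ->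
  `|weight conj (take n u)| <= prefix_bound.
Proof.
elim: k u n => [|k IHk] u n.
  move=> /= ->; apply: le_trans prefix_bound_ge.
  apply: le_trans (weight_bound _ (ltW (norm_conj_lambda_lt1 R m_gt0))) _.
  by rewrite ler_nat size_take_min geq_min orbT.
move=> /= [v kv /is_image_weight_take - /(_ n)[j uvj]].
rewrite -(subrK (conj * weight conj (take j v)) (weight conj (take n u))).
apply: le_trans (ler_normD _ _) _; rewrite -prefix_boundE lerD //.
by rewrite normrM ler_wpM2l // IHk.
Qed.

Lemma cut_project_weight c s : `|weight conj s| <= c ->
  cut_project m c (weight (@lambda R m) s).
Proof.
move=> sc; exists (Posz (count_mem la s)), (Posz (count_mem lb s)).
by rewrite !weight_count in sc *.
Qed.

(** Cylinders are neighbourhoods in the product topology. Asking for [n <= k] makes both halves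
    longer than [n], so the padding of [embed] is never read. *)
Lemma generating_word_window w n : generating_words p w ->
  exists k u, [/\ marked_image p k ([:: la], [:: la]) u, (n <= k)%N &
    forall i, (i < n)%N ->
      w (Posz i) = nth lb u.2 i /\ w (Negz i) = nth lb (rev u.1) i].
Proof.
move=> [u uP uw].
have nw (z : int) : nbhs w [set v : biinf | v z = w z].
  apply: (@proj_continuous int (fun=> letter) z w [set b | b = w z]).
  exact: (discrete_set1 (w z)).
have [||_ [[k nk <-] kw]] := uw [set embed (u k) | k in [set k | (n <= k)%N]]
    [set v : biinf | forall i : 'I_n,
      v (Posz i) = w (Posz i) /\ v (Negz i) = w (Negz i)].
- by exists n => // k /= nk; exists k.
- apply: (@filter_forall _ _ (fun (i : 'I_n) (v : biinf) =>
      v (Posz i) = w (Posz i) /\ v (Negz i) = w (Negz i)) (nbhs w)) => i.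
  exact: filterI (nw (Posz i)) (nw (Negz i)).
by exists k, (u k); split=> // i ni; have [] := kw (Ordinal ni).
Qed.

Lemma generating_word_cut_project w n : generating_words p w ->
  cut_project m (prefix_bound + prefix_bound) (left_endpoint R m w n).
Proof.
move=> gw; have b0 : 0 <= prefix_bound by apply: le_trans prefix_bound_ge.
case: n => n /=.
  have [k [u [[_ u2] nk wu]]] := generating_word_window n gw.
  have [su _] := iter_image_size u2.
  have -> : \sum_(i < n) tile_length R m (w (Posz i)) =
      weight (@lambda R m) (take n u.2).
    rewrite weight_nth ?(leq_trans nk) 1?ltnW //.
    by apply: eq_bigr => i _; rewrite /tile_length;
      have [-> _] := wu _ (ltn_ord i).
  apply: cut_project_weight; apply: le_trans (iter_image_weight_take n u2) _.
  by rewrite lerDl.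
have [k [u [[u1 _] nk wu]]] := generating_word_window n.+1 gw.
have [su _] := iter_image_size u1.
have -> : \sum_(i < n.+1) tile_length R m (w (Negz i)) =
    weight (@lambda R m) (take n.+1 (rev u.1)).
  rewrite weight_nth ?size_rev ?(leq_trans nk) 1?ltnW //.
  by apply: eq_bigr => i _; rewrite /tile_length;
      have [_ ->] := wu _ (ltn_ord i).
apply/cut_projectN/cut_project_weight/weight_take_bound => j.
exact: iter_image_weight_take u1.
Qed.

End Images.

(** * Relative denseness of realisations *)

Section Realisation.
Variables (R : realType) (m : nat).
Hypothesis m_gt0 : (0 < m)%N.
Local Notation lambda := (@lambda R m).

Lemma partial_sum_dense (r : R) (f : nat -> R) (x : R) :
  (forall i, 1 <= f i <= r) -> 0 <= x ->
  exists n, `|x - \sum_(i < n) f i| <= r.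
Proof.
move=> fr x0.
have sum_ge n : n%:R <= \sum_(i < n) f i.
  elim: n => [|n IHn]; first by rewrite big_ord0.
  by rewrite big_ord_recr -natr1 lerD //; case/andP: (fr n).
have ex : exists n, x < \sum_(i < n) f i.
  by exists (Num.bound x); apply: lt_le_trans (archi_boundP x0) (sum_ge _).
(* The sum just before the first one exceeding [x] is at most [x], and less than one tile away. *)
case: (ex_minnP ex) => -[|n]; first by rewrite big_ord0 ltNge x0.
rewrite big_ord_recr /= => xn nmin; exists n.
have nx : \sum_(i < n) f i <= x.
  by rewrite leNgt; apply/negP => /nmin; rewrite ltnn.
rewrite ger0_norm ?subr_ge0 // lerBlDl; apply/ltW/(lt_le_trans xn).
by rewrite lerD2l; case/andP: (fr n).
Qed.

Lemma tile_length_bound x : 1 <= tile_length R m x <= lambda.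
Proof.
by rewrite /tile_length; case: ifP; rewrite lexx ?andbT ltW ?lambda_gt1.
Qed.

Lemma realisation_dense w x : exists2 y, realisation m w y & `|x - y| <= lambda.
Proof.
have [x0|/ltW x0] := leP 0 x.
  have [n xn] := partial_sum_dense
    (fun i => tile_length_bound (w (Posz i))) x0.
  by exists (left_endpoint R m w (Posz n)) => //; exists (Posz n).
rewrite -oppr_ge0 in x0.
have [[|n] xn] := partial_sum_dense
  (fun i => tile_length_bound (w (Negz i))) x0.
  (* [Negz n] sums [n + 1] tiles, so the empty sum is the endpoint at position 0. *)
  exists 0; first by exists (Posz 0) => //=; rewrite big_ord0.
  by move: xn; rewrite big_ord0 !subr0 normrN.
exists (left_endpoint R m w (Negz n)); first by exists (Negz n).
by rewrite /= opprK -normrN opprD.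
Qed.

End Realisation.

(** * Passage to the hull *)

Section Hull.
Variable R : realType.

(** The radius and the allowed differences are fixed in advance: with existential constants, as in
    [Meyer], closedness could fail. *)
Definition dense_within (r : R) (D : set R) : set (pointset R) :=
  [set L | (forall x, exists2 y, L y & `|x - y| <= r) /\
    difference_set L `<=` D].

Lemma dense_within_translate r D : translation_invariant (dense_within r D).
Proof.
move=> t L [Lr LD]; split=> [x|].
  have [y Ly xy] := Lr (x - t).
  by exists (y + t); [exists y | rewrite opprD addrA addrAC].
move=> _ [_ [x Lx <-] [_ [y Ly <-] <-]]; apply: LD.
exists x => //; exists y => //.
by rewrite opprD addrACA subrr addr0.
Qed.

(** A violation is visible in a bounded region: a hole around some [x], or two points with a
    forbidden difference. A set agreeing there up to translation inherits it. *)
Lemma dense_within_closed r D : closed (dense_within r D).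
Proof.
rewrite -openC; suff : local_open (~` dense_within r D) by [].
move=> L /not_andP[/existsNP[x Lx]|LD].
  (* The ball of the inverse radius contains every point within [r] of [x]. *)
  exists ((`|x| + `|r| + 1)^-1) => [|M [t _ LM] [Mr _]].
    by rewrite invr_gt0 ltr_wpDl ?addr_ge0.
  have [y My xy] := Mr (x - t); apply: Lx; exists (y + t).
    suff : (L `&` ball (0 : R) (`|x| + `|r| + 1)^-1^-1) (y + t) by case.
    rewrite LM; split; first by exists y.
    rewrite /ball /= sub0r normrN invrK.
    have -> : y + t = x - (x - t - y) by ring.
    apply: le_lt_trans (ler_normB _ _) _.
    have := ler_norm r; lra.
  by rewrite (_ : x - (y + t) = x - t - y) //; ring.
have /existsNP[_ /not_implyP[[x Lx [y Ly <-]] nD]] := LD.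
exists ((`|x| + `|y| + 1)^-1) => [|M [t _ LM] [_ MD]].
  by rewrite invr_gt0 ltr_wpDl ?addr_ge0.
have LMt z : L z -> `|z| <= `|x| + `|y| -> M (z - t).
  move=> Lz zxy; suff [[z' Mz' <-] _] :
      (translate t M `&` ball (0 : R) (`|x| + `|y| + 1)^-1^-1) z.
    by rewrite addrK.
  by rewrite -LM; split=> //; rewrite /ball /= sub0r normrN invrK; lra.
apply: nD; rewrite -[x - y](_ : (x - t) - (y - t) = _); last by ring.
apply: MD; exists (x - t); first by apply: LMt; rewrite // lerDl.
by exists (y - t) => //; apply: LMt; rewrite // lerDr.
Qed.

End Hull.

Theorem theorem5p2 (R : realType) (m : nat) (p : 'I_m.+1 -> R)
    (m_gt0 : (0 < m)%N) (p_prob : prob_vector p) (L : set R) :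
  continuous_hull p L -> Meyer L.
Proof.
(* The window for points; their differences have window [c + c]. *)
set c := @prefix_bound R m + @prefix_bound R m.
have c0 : 0 <= c.
  by rewrite addr_ge0 // (le_trans _ (prefix_bound_ge R m_gt0)).
move=> hullL.
have [Ldense LD] : dense_within (@lambda R m) (cut_project m (c + c)) L.
  apply: hullL; split=> [|_ [w gw <-]].
    by split; [exact: dense_within_translate | exact: dense_within_closed].
  split=> [x|_ [_ [i _ <-] [_ [j _ <-] <-]]]; first exact: realisation_dense.
  have gc n := generating_word_cut_project m_gt0 p_prob n gw.
  exact: cut_projectB (gc i) (gc j).
split.
  by exists (@lambda R m); [exact: lt_trans ltr01 (lambda_gt1 R m_gt0)|].
have [r r0 rD] := cut_project_uniformly_discrete m_gt0 (addr_ge0 c0 c0).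
by exists r => // x y /LD xD /LD yD; apply: rD.
Qed.
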